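(* There is a $5.25$-competitive algorithm for non-preemptive semi-online machine minimization with a uniform deadline (i.e. $d_j=d$ for all jobs $j$).
   Context: Machine minimization with deadlines: each job $j$ of a finite instance has integer release date $r_j$, processing time $p_j$ and deadline $d_j$. A feasible non-preemptive schedule on a given number of identical machines processes each job uninterrupted on a single machine for $p_j$ consecutive time units within $[r_j,d_j]$, each machine processing at most one job at a time. $m$ is the minimum number of machines admitting such a schedule. Semi-online: each job becomes known only at its release date, decisions are made over time, and $m$ is known in advance. An algorithm is $c$-competitive if on every instance it produces a feasible schedule using at most $c\cdot m$ machines. *)

(* Defs.v *)
From HB Require Import structures.
From mathcomp Require Import all_boot all_order all_algebra.
From mathcomp Require Import reals.

Set Implicit Arguments.
Unset Strict Implicit.
Unset Printing Implicit Defensive.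
Import Order.TTheory GRing.Theory Num.Theory.
Local Open Scope ring_scope.

Record job := Job { release : int; proc_time : int; deadline : int }.

(* Default value for nth; only positions below the size of the list matter. *)
Definition job0 := Job 0 0 0.

(* An instance lists its jobs in order of arrival (ties in any order), and a
   job is identified by its position; several jobs may have the same data.
   The positions of released jobs thus carry no information on later jobs. *)
Definition instance (I : seq job) : bool :=
  sorted (fun j1 j2 => release j1 <= release j2) I
  && all (fun j => 0 < proc_time j) I.

Definition uniform_deadline (I : seq job) : Prop :=
  exists d : int, all (fun j => deadline j == d) I.

Section Scheduling.
Variable R : realType.

(* Data are integers, time is real. *)
Record schedule := Schedule { start : nat -> R; machine : nat -> nat }.

Definition completion (I : seq job) (S : schedule) (i : nat) : R :=
  start S i + (proc_time (nth job0 I i))%:~R.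

(* Non-preemptive feasibility on the k machines 0, ..., k - 1: job i occupies
   its machine during [start S i, completion I S i). *)
Definition feasible (I : seq job) (k : nat) (S : schedule) : Prop :=
  (forall i, (i < size I)%N ->
     [/\ (release (nth job0 I i))%:~R <= start S i,
         completion I S i <= (deadline (nth job0 I i))%:~R
       & (machine S i < k)%N])
  /\ (forall i j, (i < size I)%N -> (j < size I)%N -> i != j ->
        machine S i = machine S j ->
        completion I S i <= start S j \/ completion I S j <= start S i).

Definition min_machines (I : seq job) (m : nat) : Prop :=
  (exists S, feasible I m S)
  /\ (forall k, (exists S, feasible I k S) -> (m <= k)%N).

Definition released (I : seq job) (t : R) : seq job :=
  [seq j <- I | (release j)%:~R <= t].

(* A m t h i = Some q: given the optimal number m of machines and the list h
   of the jobs released up to time t, start job i at time t on machine q.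
   A m t h i = None: do not start job i at time t.
   Being deterministic, A can recompute its own past decisions from h, so
   these need not be passed to it. *)
Definition semi_online_algorithm := nat -> R -> seq job -> nat -> option nat.

(* Each job is started exactly once, at the time and on the machine given by
   S. As A reads only released I t at time t, decisions cannot depend on jobs
   released after t, and they are irrevocable. *)
Definition produces (A : semi_online_algorithm) (m : nat) (I : seq job)
    (S : schedule) : Prop :=
  forall i, (i < size I)%N -> forall (t : R) (q : nat),
    A m t (released I t) i = Some q <-> t = start S i /\ q = machine S i.

Definition competitive (P : seq job -> Prop) (c : R)
    (A : semi_online_algorithm) : Prop :=
  forall (I : seq job) (m : nat),
    instance I -> P I -> min_machines I m ->
    exists (S : schedule) (k : nat),
      [/\ produces A m I S, feasible I k S & k%:R <= c * m%:R].

End Scheduling.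

(* Main.v *)
(* A job is loose if 3p < d - r and tight otherwise. Tight jobs get 3m machines and
   start at their release: tight jobs active at time t that share a machine of the
   optimum are at most three in number, as a fourth would not fit before d. Loose
   jobs are list-scheduled in order of arrival on k = floor(9m/4) machines. By the
   potential argument in [work_deficit], the work done on them by time t lags behind
   the optimum by at most (2k+1-3m)(d-t)/3. A loose job that is late would have seen
   all k machines busy from r to d - p, more work than this lag plus the capacity
   m(d-r) of the optimum. Since k >= 9m/4 - 3/4, rounding k down costs nothing. *)
Require Import Defs.
From mathcomp Require Import all_boot all_order all_algebra.
From mathcomp Require Import reals zify.

(** * Load and accumulated work in discrete time *)

Definition runs (s p : nat -> nat) (t j : nat) : bool := s j <= t < s j + p j.

Definition load (n : nat) (C : pred nat) (s p : nat -> nat) (t : nat) : nat :=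
  count (fun j => C j && runs s p t j) (iota 0 n).

(** Truncated subtraction makes a job not started by [t] contribute 0. *)
Definition work (n : nat) (C : pred nat) (s p : nat -> nat) (t : nat) : nat :=
  \sum_(j <- iota 0 n | C j) minn (t - s j) (p j).

Section Work.
Variables (n : nat) (C : pred nat) (s p : nat -> nat).
Local Notation load := (load n C s p).
Local Notation work := (work n C s p).

Lemma workS t : work t.+1 = work t + load t.
Proof.
rewrite /load -sum1_count big_mkcondr -big_split /=; apply: eq_bigr => j _.
by rewrite /runs; case: ifP; lia.
Qed.

Lemma work_ge c a b : a <= b -> (forall t, a <= t < b -> c <= load t) ->
  work a + c * (b - a) <= work b.
Proof.
elim: b => [|b IHb] leab loadc;
  first by rewrite (_ : a = 0) ?subn0 ?muln0 ?addn0 //; lia.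
have [->|ltab] : a = b.+1 \/ a <= b by lia.
  by rewrite subnn; lia.
have {}IHb : work a + c * (b - a) <= work b.
  by apply: IHb => // t ht; apply: loadc; lia.
have := loadc b; rewrite workS subSn // mulnS; lia.
Qed.

Lemma work_le c a b : a <= b -> (forall t, load t <= c) ->
  work b <= work a + c * (b - a).
Proof.
move=> + loadc; elim: b => [|b IHb] leab;
  first by rewrite (_ : a = 0) ?subn0 ?muln0 ?addn0 //; lia.
have [->|ltab] : a = b.+1 \/ a <= b by lia.
  by rewrite subnn; lia.
by have := IHb ltab; have := loadc b; rewrite workS subSn // mulnS; lia.
Qed.

(** Jobs running at [t] occupy distinct machines, so [mu] embeds them into [iota 0 m]. *)
Lemma load_le mu m t :
  (forall j, j < n -> C j -> mu j < m) ->
  (forall i j, i < n -> j < n -> C i -> C j -> i != j -> mu i = mu j ->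
     s i + p i <= s j \/ s j + p j <= s i) ->
  load t <= m.
Proof.
move=> mum dis; rewrite /load -size_filter -(size_map mu) -(size_iota 0 m).
apply: uniq_leq_size.
  rewrite map_inj_in_uniq ?filter_uniq ?iota_uniq // => i j.
  rewrite !mem_filter !mem_iota /runs => /andP[/andP[Ci ri] ni] /andP[/andP[Cj rj] nj].
  move=> eqmu; apply/eqP; apply: contraT => neij.
  by case: (dis i j _ _ Ci Cj neij eqmu); lia.
move=> _ /mapP[j + ->]; rewrite mem_filter !mem_iota.
by move=> /andP[/andP[Cj _] nj]; rewrite mum //; lia.
Qed.

End Work.

(** * Loose jobs: lag of the greedy schedule behind a reference schedule *)

Section Loose.
Variables (n m k d : nat) (C : pred nat) (r p s o : nat -> nat).
Hypothesis s_ge : forall i, i < n -> C i -> r i <= s i.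
Hypothesis greedy : forall i t, i < n -> C i -> r i <= t < s i ->
  k <= load n C s p t.
Hypothesis loose : forall i, i < n -> C i -> 3 * p i < d - r i.
Hypothesis o_ge : forall i, i < n -> C i -> r i <= o i.
Hypothesis o_le : forall i, i < n -> C i -> o i + p i <= d.
Hypothesis load_o : forall t, load n C o p t <= m.
Hypothesis k_gt1 : 1 < k.
Hypothesis k_ge : 9 * m <= 4 * k + 3.

Local Notation WA := (work n C s p).
Local Notation WO := (work n C o p).

(* The surplus (2k+1-3m)(d-t)/3 shrinks slower than the deficit does when at
   least (2k+1)/3 machines are busy. Otherwise no job waits, so the deficit is
   at most the remaining work of the running jobs: either each of them has at
   most (d-t)/3 left, or one has more, hence has spent two thirds of its time
   since release waiting, while all k machines were busy. *)
Lemma work_deficit t : t <= d ->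
  3 * WO t + 3 * m * (d - t) <= 3 * WA t + (2 * k + 1) * (d - t).
Proof.
elim/ltn_ind: t => -[|t] IH letd.
  have -> : WO 0 = 0 by rewrite /work big1 // => i _; lia.
  by rewrite muln0 add0n; apply: leq_trans (leq_addl _ _); rewrite leq_mul2r; lia.
have [Nge|Nlt] := leqP (2 * k + 1) (3 * load n C s p t).
  have := IH t (ltnSn t) (ltnW letd).
  have := load_o t; rewrite !workS (_ : d - t = (d - t.+1).+1); last lia.
  rewrite !mulnS; lia.
have Nk : load n C s p t < k by lia.
have started i : i < n -> C i -> r i <= t -> s i <= t.
  move=> ni Ci rt; rewrite leqNgt; apply/negP => ts.
  by have := greedy i t ni Ci; lia.
have [/allP small|/allPn[i]] := boolP (all (fun i =>
    C i && runs s p t i ==> (3 * (s i + p i - t.+1) <= d - t.+1)) (iota 0 n)).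
  (* Job by job: one released after [t] adds nothing to [WO t.+1], a finished one counts in full in
     [WA t.+1], a running one lacks at most [(d - t.+1) / 3]. *)
  suff : 3 * WO t.+1 <= 3 * WA t.+1 + load n C s p t * (d - t.+1).
    set a := d - t.+1; set N := load _ _ _ _ _ in Nlt Nk *; move=> le1.
    (* [3 * N <= 2 * k] and [k_ge] add up to [9 * m + 3 * N <= 6 * k + 3]. *)
    have : (3 * m + N) * a <= (2 * k + 1) * a by rewrite leq_mul2r; lia.
    by rewrite mulnDl; lia.
  rewrite /work !big_distrr /= /load -sum1_count big_distrl /= big_mkcondr.
  rewrite -big_split /= big_seq_cond [leqRHS]big_seq_cond; apply: leq_sum => i.
  rewrite mem_iota => /andP[ni Ci]; have {}ni : i < n by lia.
  have := small i; rewrite mem_iota Ci add0n ni /= => /(_ isT)/implyP.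
  have := o_ge i ni Ci; have := started i ni Ci; have := s_ge i ni Ci.
  rewrite /runs mul1n; case: ifP; lia.
rewrite mem_iota negb_imply => /andP[_ ni] /andP[/andP[Ci rit] big].
have {}ni : i < n by lia.
have si := s_ge i ni Ci; have li := loose i ni Ci; move: rit; rewrite /runs => rit.
(* Restart from the release of [i]: since then the reference gains at most [m] per step, the greedy
   schedule at least [k] during the wait and 1 while [i] runs. *)
have := IH (r i) ltac:(lia) ltac:(lia).
have wo := work_le n C o p m (r i) t.+1 ltac:(lia) load_o.
have wa1 : WA (r i) + k * (s i - r i) <= WA (s i).
  by apply: work_ge => // u hu; apply: greedy hu.
have wa2 : WA (s i) + 1 * (t.+1 - s i) <= WA t.+1.
  apply: work_ge => [|u hu]; first lia.
  rewrite /load -has_count; apply/hasP; exists i; first by rewrite mem_iota; lia.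
  by rewrite Ci /runs; lia.
move: wo wa1 wa2 big rit li.
move: (WO _) (WO _) (WA _) (WA _) (WA _) => w1 w2 w3 w4 w5 wo wa1 wa2 big rit li.
have [w Ew] : {w | s i = r i + w} by exists (s i - r i); lia.
have [x Ex] : {x | t.+1 = r i + w + x} by exists (t.+1 - s i); lia.
have [y Ey] : {y | d = r i + w + x + y} by exists (d - t.+1); lia.
rewrite Ex Ew Ey in wo wa1 wa2 *.
(* Here [w] is the wait of [i], [x] its time run so far, [y] the time left to [d]; [big] and [li]
   give [3 * x + y < 3 * p i < w + x + y]. *)
have kx : 2 * k * x + w <= k * w + 2 * x.
  have : 2 * x <= w by lia.
  by nia.
rewrite addKn -!addnA addKn.
rewrite -addnA addKn in wo; rewrite addKn in wa1; rewrite addKn mul1n in wa2.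
by lia.
Qed.

Lemma loose_on_time i : i < n -> C i -> s i + p i <= d.
Proof.
move=> ni Ci; rewrite leqNgt; apply/negP => late.
have oi := o_ge i ni Ci; have oi' := o_le i ni Ci; have li := loose i ni Ci.
have def := work_deficit (r i) ltac:(lia).
have wo := work_le n C o p m (r i) d ltac:(lia) load_o.
have wa : WA (r i) + k * (d - p i - r i) <= WA (d - p i).
  by apply: work_ge => [|u hu]; [lia | apply: (greedy i) => //; lia].
(* The reference has done every job in full by [d], whereas [i] has not started by [d - p i]. *)
have tot : WA (d - p i) + p i <= WO d.
  have ii : i \in [seq j <- iota 0 n | C j].
    by rewrite mem_filter Ci mem_iota; lia.
  rewrite /work -!(big_filter _ C) !(bigD1_seq i ii) ?filter_uniq ?iota_uniq //=.
  rewrite (_ : minn (d - p i - s i) _ = 0); last lia.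
  rewrite add0n addnC; apply: leq_add; first lia.
  rewrite big_seq_cond [leqRHS]big_seq_cond; apply: leq_sum => j.
  rewrite mem_filter mem_iota => /andP[/andP[Cj nj] _].
  by have := o_le j ltac:(lia) Cj; lia.
have [y Ey] : {y | d = r i + p i + y} by exists (d - p i - r i); lia.
move: def wo wa tot; rewrite Ey.
have -> : r i + p i + y - r i = p i + y by lia.
have -> : r i + p i + y - p i - r i = y by lia.
(* This is [(k - 1) * (y - 2 * p i) > 0], from looseness and [k_gt1]; the bounds above imply the
   opposite. *)
have : 2 * k * p i + y < k * y + 2 * p i.
  have : 2 * p i < y by lia.
  by nia.
by lia.
Qed.

End Loose.

(** * Tight jobs: counting the active ones per reference machine *)

Lemma count_fibers (T : Type) (l : seq T) (P : pred T) (f : T -> nat) c m :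
  (forall q, count (fun j => P j && (f j == q)) l <= c) ->
  count (fun j => P j && (f j < m)) l <= c * m.
Proof.
move=> fib; elim: m => [|m IHm].
  by rewrite (eq_count (a2 := pred0)) ?count_pred0 // => j /=; rewrite andbF.
rewrite mulnS; apply: leq_trans (leq_add (fib m) IHm).
rewrite -count_predUI; apply: leq_trans (leq_addr _ _); apply: sub_count => j /=.
by case: (P j) => //=; lia.
Qed.

Section Tight.
Variables (n m d : nat) (C : pred nat) (r p o mu : nat -> nat).
Hypothesis r_mono : forall i j, i <= j -> j < n -> r i <= r j.
Hypothesis tight : forall i, i < n -> C i -> d - r i <= 3 * p i.
Hypothesis o_ge : forall i, i < n -> r i <= o i.
Hypothesis o_le : forall i, i < n -> o i + p i <= d.
Hypothesis mu_lt : forall i, i < n -> mu i < m.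
Hypothesis o_disjoint : forall i j, i < n -> j < n -> i != j ->
  mu i = mu j -> o i + p i <= o j \/ o j + p j <= o i.

(* Four active jobs on one machine of the reference schedule would not fit: the
   first one released has length more than t - r, the others at least (d-t)/3. *)
Lemma load_tight t : load n C r p t <= 3 * m.
Proof.
have -> : load n C r p t =
    count (fun j => (C j && runs r p t j) && (mu j < m)) (iota 0 n).
  apply: eq_in_count => j; rewrite mem_iota => nj.
  by rewrite mu_lt ?andbT //; lia.
apply: count_fibers => q; rewrite -size_filter.
set X := filter _ _.
have Xin j : j \in X -> [/\ j < n, C j, runs r p t j & mu j = q].
  by rewrite mem_filter mem_iota => /andP[/andP[/andP[-> ->] /eqP ->]].
have : sorted ltn X by apply: sorted_filter; [exact: ltn_trans|exact: iota_ltn_sorted].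
have : uniq X by rewrite filter_uniq ?iota_uniq.
case EX : X => [//|x l] uX /(order_path_min ltn_trans)/allP xmin.
have xX : x \in X by rewrite EX mem_head.
have [nx Cx + mux] := Xin x xX; rewrite /runs => rx.
(* The jobs of [X] share one reference machine, so [load_le] with a constant machine map bounds
   their load by 1; as [x] has the least index, all run within [[r x, d]]. *)
have sum_le : \sum_(j <- X) p j <= d - r x.
  have := work_le n (mem X) o p 1 (r x) d.
  have -> : work n (mem X) o p (r x) = 0.
    rewrite /work big1_seq // => j /andP[jX _]; have [nj _ _ _] := Xin j jX.
    have : r x <= r j.
      move: jX; rewrite /= EX inE => /orP[/eqP->//|/xmin ltxj].
      by apply: r_mono => //; exact: ltnW.
    by have := o_ge j nj; lia.
  have -> : work n (mem X) o p d = \sum_(j <- X) p j.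
    rewrite /work -big_filter.
    have -> : [seq j <- iota 0 n | mem X j] = X.
      rewrite /X; apply: eq_in_filter => j jn.
      by rewrite /= mem_filter jn andbT.
    apply: eq_big_seq => j /Xin[nj _ _ _].
    by have := o_le j nj; lia.
  rewrite mul1n add0n; apply; first by have := o_ge x nx; have := o_le x nx; lia.
  move=> u; apply: (@load_le n _ o p (fun=> 0)) => // i j ni nj.
  move=> /Xin[_ _ _ mui] /Xin[_ _ _ muj] neij _.
  by apply: o_disjoint => //; rewrite mui muj.
have sum_ge : size l * (d - t) <= 3 * \sum_(j <- l) p j.
  rewrite -sum1_size big_distrl big_distrr /= big_seq [leqRHS]big_seq.
  apply: leq_sum => j jl; have [] := Xin j; first by rewrite EX inE jl orbT.
  by move=> nj Cj + _; rewrite /runs; have := tight j nj Cj; lia.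
have dt : t < d.
  have := o_ge x nx; have := o_le x nx; lia.
rewrite EX big_cons in sum_le => /=; rewrite leqNgt; apply/negP => l3.
have : 3 * (d - t) <= size l * (d - t) by rewrite leq_mul2r; lia.
lia.
Qed.

End Tight.

(** * List scheduling with recorded free times *)

Section Fifo.
Variables (n : nat) (r p s mach : nat -> nat) (free : nat -> nat -> nat).
Hypothesis free0 : forall q, free 0 q = 0.
Hypothesis freeS : forall i q, i < n ->
  free i.+1 q = if q == mach i then s i + p i else free i q.
Hypothesis sE : forall i, i < n -> s i = maxn (r i) (free i (mach i)).

(* If the last job on q starts after t, it starts when q becomes free, so q was
   already taken before it. *)
Lemma free_busy i q t : i <= n -> (forall j, j < i -> r j <= t) ->
  t < free i q -> exists j, [/\ j < i, mach j = q & runs s p t j].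
Proof.
elim: i => [|i IHi] lein rt; first by rewrite free0.
have {}IHi : t < free i q -> exists j, [/\ j < i.+1, mach j = q & runs s p t j].
  move=> tf; case: (IHi _ _ tf) => [||j [ji qj tj]];
    [lia|by move=> j ji; apply: rt; lia|].
  by exists j; split=> //; lia.
rewrite freeS //; case: eqP => [eqq|_] // tc; subst q.
have [st|ts] := leqP (s i) t; first by exists i; split=> //; rewrite /runs; lia.
by apply: IHi; have := rt i (ltnSn i); have := sE i lein; lia.
Qed.

(** By [sE] no job starts before its machine is free, so free times never decrease. *)
Lemma completion_le_free i j : j < i -> i <= n -> s j + p j <= free i (mach j).
Proof.
elim: i => // i IHi ji lein; rewrite freeS //.
have [->|lt] : j = i \/ j < i by lia.
  by rewrite eqxx.
have := IHi lt ltac:(lia); case: eqP => // ->.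
by have := sE i lein; lia.
Qed.

Lemma fifo_disjoint i j : i < n -> j < n -> i != j -> mach i = mach j ->
  s i + p i <= s j \/ s j + p j <= s i.
Proof.
move=> ni nj neij eqm; have [ltij|ltji] : i < j \/ j < i by lia.
  left; have := completion_le_free _ _ ltij (ltnW nj); rewrite eqm.
  by have := sE j nj; lia.
right; have := completion_le_free _ _ ltji (ltnW ni); rewrite -eqm.
by have := sE i ni; lia.
Qed.

(** If [i] waits at [t], its machine, hence by minimality every machine of the block, becomes free
    only after [t]; [free_busy] then finds a running job on each. *)
Lemma fifo_greedy (C : pred nat) lo k i t :
  (forall i j, i <= j -> j < n -> r i <= r j) ->
  i < n -> (forall q, q \in iota lo k -> free i (mach i) <= free i q) ->
  (forall j, j < i -> mach j \in iota lo k -> C j) ->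
  r i <= t < s i -> k <= load i C s p t.
Proof.
move=> r_mono ni best Cin ht.
rewrite /load -size_filter -(size_map mach) -{1}(size_iota lo k).
apply: uniq_leq_size (iota_uniq _ _) _ => q qin.
case: (@free_busy i q t) => [||| j [ji qj tj]].
- exact: ltnW.
- by move=> j ji; have := r_mono j i (ltnW ji) ni; lia.
- by have := best q qin; have := sE i ni; lia.
apply/mapP; exists j => //; rewrite mem_filter mem_iota tj andbT.
by rewrite Cin ?qj.
Qed.

End Fifo.

Lemma load_mono n1 n2 C s p t : n1 <= n2 -> load n1 C s p t <= load n2 C s p t.
Proof. by move=> le12; rewrite /load -(subnKC le12) iotaD count_cat leq_addr. Qed.

(** * The algorithm and its independence of later arrivals *)

Definition argmin (f : nat -> nat) (l : seq nat) : nat :=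
  head 0 (sort (relpre f leq) l).

Lemma argmin_mem f l : l != [::] -> argmin f l \in l.
Proof.
rewrite /argmin -(mem_sort (relpre f leq)) -size_eq0 -(size_sort (relpre f leq)).
by case: sort => // x s _; rewrite mem_head.
Qed.

Lemma argmin_le f l x : x \in l -> f (argmin f l) <= f x.
Proof.
have : sorted (relpre f leq) (sort (relpre f leq) l).
  by apply: sort_sorted => y z; exact: leq_total.
rewrite /argmin -(mem_sort (relpre f leq)); case: sort => //= y s.
move=> /(order_path_min (fun _ _ _ => @leq_trans _ _ _))/allP ymin.
by rewrite inE => /orP[/eqP->|/ymin].
Qed.

Import Order.TTheory GRing.Theory Num.Theory.
Local Open Scope ring_scope.

Definition is_loose (j : job) : bool := 3 * proc_time j < deadline j - release j.

(** Disjoint blocks keep the two classes from delaying each other. *)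
Definition pool (m : nat) (j : job) : seq nat :=
  if is_loose j then iota (3 * m) (9 * m %/ 4) else iota 0 (3 * m).

(* The time origin of the simulation: the first release date. *)
Definition origin (h : seq job) : int := release (head job0 h).

Definition rel_date (b : int) (j : job) : nat := `|release j - b|%N.
Definition duration (j : job) : nat := `|proc_time j|%N.

(* In the next three definitions [f q] is the time at which machine q becomes
   free; times are counted from the origin [b]. *)
Definition fifo_pick (m : nat) (f : nat -> nat) (j : job) : nat :=
  argmin f (pool m j).

Definition fifo_begin (m : nat) (b : int) (f : nat -> nat) (j : job) : nat :=
  maxn (rel_date b j) (f (fifo_pick m f j)).

Definition fifo_step (m : nat) (b : int) (f : nat -> nat) (j : job) : nat -> nat :=
  fun q => if q == fifo_pick m f j then (fifo_begin m b f j + duration j)%N else f q.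

Definition fifo_free (m : nat) (h : seq job) (i : nat) : nat -> nat :=
  foldl (fifo_step m (origin h)) (fun=> 0%N) (take i h).

Definition fifo_start (m : nat) (h : seq job) (i : nat) : nat :=
  fifo_begin m (origin h) (fifo_free m h i) (nth job0 h i).

Definition fifo_machine (m : nat) (h : seq job) (i : nat) : nat :=
  fifo_pick m (fifo_free m h i) (nth job0 h i).

Definition fifo (R : realType) (m : nat) (h : seq job) : schedule R :=
  Schedule (fun i => (origin h + (fifo_start m h i)%:Z)%:~R) (fifo_machine m h).

Definition fifo_algorithm (R : realType) : semi_online_algorithm R :=
  fun m t h i => if (i < size h)%N && (t == start (fifo R m h) i)
    then Some (machine (fifo R m h) i) else None.

Lemma fifo_freeS m h i q : (i < size h)%N ->
  fifo_free m h i.+1 q = if q == fifo_machine m h i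
    then (fifo_start m h i + duration (nth job0 h i))%N else fifo_free m h i q.
Proof. by move=> ih; rewrite /fifo_free (take_nth job0) // foldl_rcons. Qed.

(** The simulation of job [i] reads only the first [i.+1] jobs, so the list released so far already
    fixes the final decision. *)
Lemma fifo_take (R : realType) m h l i : (i < l)%N ->
  start (fifo R m (take l h)) i = start (fifo R m h) i /\
  machine (fifo R m (take l h)) i = machine (fifo R m h) i.
Proof.
move=> il; rewrite /fifo /= /fifo_start /fifo_machine /fifo_free.
have -> : origin (take l h) = origin h by case: h l il => [|j h] [].
by rewrite take_takel ?nth_take // ltnW.
Qed.

Lemma released_take (R : realType) (I : seq job) (t : R) :
  sorted (fun j1 j2 => release j1 <= release j2) I ->
  released I t = take (size (released I t)) I /\
  forall i, (i < size I)%N ->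
    (i < size (released I t))%N = ((release (nth job0 I i))%:~R <= t).
Proof.
rewrite /released; elim: I => [//|j I IH] /= pI.
have [IH1 IH2] := IH (path_sorted pI).
have jmin : all (fun j' => release j <= release j') I.
  by apply: order_path_min pI => x y z; exact: le_trans.
have [jt|tj] := leP (release j)%:~R t.
  split; first by rewrite /= -IH1.
  by case=> [|i] //= iI; rewrite ltnS; exact: IH2.
have late : all (predC (fun j' => (release j')%:~R <= t)) I.
  apply: sub_all jmin => j' /= jj'; rewrite -ltNge.
  by apply: lt_le_trans tj _; rewrite ler_int.
have -> : [seq j' <- I | (release j')%:~R <= t] = [::].
  by apply: size0nil; rewrite size_filter; move: late; rewrite all_predC has_count; lia.
split=> // -[|i] /= iI; first by rewrite leNgt tj.
by apply/esym/negbTE/(all_nthP job0 late).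
Qed.

(** * Feasibility and competitive ratio *)

Theorem theorem16 (R : realType) :
  exists A : semi_online_algorithm R,
    competitive uniform_deadline (21%:R / 4%:R : R) A.
Proof.
exists (fifo_algorithm R) => I m /andP[sortI posI] [d dI] [[S [feasS disS]] _].
pose n := size I; pose b := origin I.
pose J i := nth job0 I i.
pose r i := rel_date b (J i); pose p i := duration (J i).
(* Rounding the starting times down keeps an integral instance feasible. *)
pose D := `|d - b|%N; pose o i := `|Num.floor (start S i) - b|%N.
pose s := fifo_start m I; pose mach := fifo_machine m I.
pose L i := is_loose (J i).
have relmono i j : (i <= j)%N -> (j < n)%N -> release (J i) <= release (J j).
  move=> ij nj.
  apply: (sorted_leq_nth _ _ job0 sortI); rewrite ?inE //.
  - by move=> x y z; exact: le_trans.
  - exact: leq_ltn_trans nj.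
have facts i : (i < n)%N -> [/\ release (J i) = b + (r i)%:Z,
    proc_time (J i) = (p i)%:Z, (0 < p i)%N, deadline (J i) = b + D%:Z
    & [/\ Num.floor (start S i) = b + (o i)%:Z, (r i <= o i)%N & (o i + p i <= D)%N]].
  move=> ni; have [rs cd _] := feasS i ni.
  have p0 : 0 < proc_time (J i) by apply: (all_nthP job0 posI).
  have /eqP dd : deadline (J i) == d by apply: (all_nthP job0 dI).
  have br : b <= release (J i).
    by rewrite /b /origin -nth0; apply: relmono.
  have rf : release (J i) <= Num.floor (start S i) by rewrite floor_ge_int.
  have fd : Num.floor (start S i) + proc_time (J i) <= d.
    rewrite -(ler_int R) -dd; apply: le_trans cd.
    by rewrite intrD lerD2r floor_le.
  by rewrite /r /p /D /o /rel_date /duration dd; split; [..|split]; lia.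
have m_gt0 i : (i < n)%N -> (0 < m)%N.
  by move=> /feasS[_ _]; exact: leq_ltn_trans.
have o_dis i j : (i < n)%N -> (j < n)%N -> i != j -> machine S i = machine S j ->
    (o i + p i <= o j)%N \/ (o j + p j <= o i)%N.
  have one i' j' : (i' < n)%N -> (j' < n)%N ->
      completion I S i' <= start S j' -> (o i' + p i' <= o j')%N.
    move=> /facts[_ pE _ _ [fi _ _]] /facts[_ _ _ _ [fj _ _]] le.
    have : Num.floor (start S i') + proc_time (J i') <= Num.floor (start S j').
      rewrite floor_ge_int; apply: le_trans le.
      by rewrite intrD lerD2r floor_le.
    by lia.
  by move=> ni nj nij eqm; case: (disS i j ni nj nij eqm); [left|right]; exact: one.
have free0 q : fifo_free m I 0 q = 0%N by rewrite /fifo_free take0.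
have freeS i q : (i < n)%N -> fifo_free m I i.+1 q =
    if q == mach i then (s i + p i)%N else fifo_free m I i q.
  by move=> ni; rewrite fifo_freeS.
have sE i : (i < n)%N -> s i = maxn (r i) (fifo_free m I i (mach i)) by [].
have r_mono i j : (i <= j)%N -> (j < n)%N -> (r i <= r j)%N.
  move=> ij nj; have := relmono i j ij nj.
  have [+ _ _ _ _] := facts j nj; have [+ _ _ _ _] := facts i (leq_ltn_trans ij nj).
  by lia.
have machP i : (i < n)%N -> mach i \in pool m (J i).
  move=> ni; apply: argmin_mem; have := m_gt0 i ni; rewrite -size_eq0 /pool.
  by case: ifP => _; rewrite size_iota; lia.
have best i q : q \in pool m (J i) ->
    (fifo_free m I i (mach i) <= fifo_free m I i q)%N by exact: argmin_le.
have looseP i : (i < n)%N -> L i = (3 * p i < D - r i)%N.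
  by move=> /facts[rE pE p0 dE [_ ro oD]]; rewrite /L /is_loose; lia.
have load_o C t : (load n C o p t <= m)%N.
  apply: (load_le n C o p (machine S)) => [j nj _|i j ni nj _ _].
    by have [] := feasS j nj.
  exact: o_dis.
have greedyL i t : (i < n)%N -> L i -> (r i <= t < s i)%N ->
    (9 * m %/ 4 <= load n L s p t)%N.
  move=> ni Li ht; apply: leq_trans (load_mono i n _ _ _ _ (ltnW ni)).
  apply: (fifo_greedy n r p s mach _ free0 freeS sE L (3 * m) _ i t r_mono ni) => //.
    by move=> q qin; apply: best; rewrite /pool -/(L i) Li.
  move=> j ji; have := machP j (ltn_trans ji ni).
  by rewrite /pool -/(L j); case: (L j) => //; rewrite !mem_iota; lia.
(* If [i] had to wait, all [3 * m] tight machines would run earlier tight jobs at [r i], each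
   started at its release by induction; adding [i] contradicts [load_tight]. *)
have tight_start i : (i < n)%N -> ~~ L i -> s i = r i.
  elim/ltn_ind: i => i IH ni Ti; have := sE i ni.
  have [//|lt_rs] := eqVneq (s i) (r i) => si.
  pose T j := ~~ L j.
  have : (3 * m <= load i T s p (r i))%N.
    apply: (fifo_greedy n r p s mach _ free0 freeS sE T 0 _ i _ r_mono ni) => //.
    - by move=> q qin; apply: best; rewrite /pool -/(L i) (negbTE Ti).
    - move=> j ji; have := machP j (ltn_trans ji ni).
      by rewrite /T /pool -/(L j); case: (L j) => //; rewrite !mem_iota; lia.
    - by lia.
  have -> : load i T s p (r i) = load i T r p (r i).
    apply: eq_in_count => j; rewrite mem_iota => ji; have {}ji : (j < i)%N by lia.
    rewrite /T; case: (boolP (L j)) => //= Tj.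
    by rewrite /runs (IH j) // (ltn_trans ji).
  have : (load i.+1 T r p (r i) <= 3 * m)%N.
    apply: (load_tight i.+1 m D T r p o (machine S)).
    - by move=> j k jk ki; apply: r_mono => //; lia.
    - by move=> j ji; rewrite /T looseP; lia.
    - by move=> j ji; have [_ _ _ _ [_]] := facts j ltac:(lia).
    - by move=> j ji; have [_ _ _ _ [_]] := facts j ltac:(lia).
    - by move=> j ji; have [] := feasS j ltac:(rewrite -/n; lia).
    - by move=> j k ji ki; apply: o_dis; lia.
  rewrite /load -[X in iota 0 X]addn1 iotaD count_cat /= add0n {2}/T Ti /runs.
  by have [_ _ + _ _] := facts i ni; lia.
have on_time i : (i < n)%N -> (s i + p i <= D)%N.
  move=> ni; have [Li|Ti] := boolP (L i); last first.
    by rewrite tight_start //; have [_ _ _ _ [_]] := facts i ni; lia.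
  have m0 := m_gt0 i ni.
  apply: (loose_on_time n m (9 * m %/ 4) D L r p s o) => //.
  - by move=> j nj _; rewrite sE // leq_maxl.
  - by move=> j nj; rewrite looseP.
  - by move=> j nj _; have [_ _ _ _ [_]] := facts j nj.
  - by move=> j nj _; have [_ _ _ _ [_]] := facts j nj.
  (* [m > 0] gives [9 * m %/ 4 >= 2]; next, [k_ge] holds as the remainder is at most 3. *)
  - by lia.
  - by lia.
have complE i : (i < n)%N ->
    completion I (fifo R m I) i = (b + (s i + p i)%N%:Z)%:~R.
  move=> /facts[_ pE _ _ _]; rewrite /completion /= -/(J i) pE -intrD.
  by congr (_%:~R); rewrite -/b -/(s i); lia.
exists (fifo R m I), (3 * m + 9 * m %/ 4)%N; split.
- move=> i ni t q; rewrite /fifo_algorithm.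
  have [relE relP] := released_take R I t sortI.
  have rs : (release (J i))%:~R <= start (fifo R m I) i.
    have [rE _ _ _ _] := facts i ni.
    by rewrite /= ler_int rE -/b -/(s i) sE //; lia.
  have [il|li] := boolP (i < size (released I t))%N; last first.
    split=> // -[tE _]; move: li; rewrite relP // -/(J i) tE rs //.
  rewrite relE; have [-> ->] := fifo_take R m I _ i il; rewrite /=.
  by case: eqP => [->|ne]; split=> [[]|[]] // _ ->.
- split=> [i ni|i j ni nj nij eqm].
    have [rE _ _ dE _] := facts i ni; split.
    + by rewrite -/(J i) /= ler_int rE -/b -/(s i) sE //; lia.
    + by rewrite complE // -/(J i) ler_int dE; have := on_time i ni; lia.
    + have := machP i ni; rewrite /pool /= -/(mach i).
      by case: ifP => _; rewrite mem_iota; lia.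
  rewrite !complE //= !ler_int -/b -/(s i) -/(s j).
  case: (fifo_disjoint n r p s mach _ freeS sE i j ni nj nij eqm).
    by left; lia.
  by right; lia.
- rewrite mulrAC ler_pdivlMr ?ltr0n // -!natrM ler_nat; lia.
Qed.
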